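(* Let $r,\sigma,k,\theta,a,\beta>0$ be constants and suppose that $$\psi=1+\frac{1-\gamma}{\chi}=2-\gamma+\frac{(1-\gamma)^2}{\gamma}\rho^2\in(0,1),\qquad\rho\in(0,1),\qquad\delta>0,\qquad\gamma>1,$$ where $\chi:=\frac{\gamma}{\gamma+(1-\gamma)\rho^2}$. Consider the linear equation on $\mathbb R$ $$\frac{a^2}{2}h''(y)+\Big\{k\theta-\Big[k+\Big(1-\frac1\gamma\Big)a\rho\Big]y\Big\}h'(y)-(K_0+K_2y^2)h(y)+\beta^\psi=0,\qquad(\ast)$$ and let $\phi_1,\phi_2$ be the functions in the context with Wronskian $\mathcal W(y):=\phi_1(y)\phi_2'(y)-\phi_1'(y)\phi_2(y)$. Fix $y_0\in\mathbb R$. Then every solution of $(\ast)$ has the form $$h(y)=C_1\phi_1(y)+C_2\phi_2(y)+\frac{2\beta^\psi}{a^2}\Big[\phi_1(y)\int_{y_0}^y\frac{\phi_2(z)}{\mathcal W(z)}dz-\phi_2(y)\int_{y_0}^y\frac{\phi_1(z)}{\mathcal W(z)}dz\Big]$$ for some $C_1,C_2\in\mathbb R$. Moreover, the bounded positive solution of $(\ast)$ is unique and given by $$h(y)=\frac{2\beta^\psi}{a^2}\Big[\phi_1(y)\int_{-\infty}^y\frac{\phi_2(z)}{\mathcal W(z)}dz+\phi_2(y)\int_y^\infty\frac{\phi_1(z)}{\mathcal W(z)}dz\Big];$$ equivalently, its constants in the general form are $C_1=\frac{2\beta^\psi}{a^2}\int_{-\infty}^{y_0}\frac{\phi_2(z)}{\mathcal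 W(z)}dz$ and $C_2=\frac{2\beta^\psi}{a^2}\int_{y_0}^\infty\frac{\phi_1(z)}{\mathcal W(z)}dz$.
   Context: Constants: $K_0:=\frac{\gamma-1}{\chi}\big(r-\frac{\delta\psi}{\psi-1}\big)>0$, $K_2:=\frac{\gamma-1}{2\gamma\chi}>0$, $K_1:=k+(1-\frac1\gamma)a\rho>0$, $I(y):=\frac{k\theta}{a^2}y-\frac{K_1}{2a^2}y^2$, $m:=\sqrt{\frac{2K_2}{a^2}+\frac{K_1^2}{a^4}}$, $y_*:=\frac{k\theta K_1}{a^4m^2}$, $\nu:=\frac{K_1}{a^2}-\frac{2K_0}{a^2}-\frac{k^2\theta^2}{a^4}+m^2y_*^2$, $\alpha:=\frac{\nu}{2m}-\frac12<0$. $D_\alpha$ denotes the parabolic cylinder function of index $\alpha$, a solution of the Weber equation $v''+(\alpha+\frac12-\frac{x^2}{4})v=0$; for $\alpha<0$, $D_\alpha(x)=\frac{e^{-x^2/4}}{\Gamma(-\alpha)}\int_0^\infty t^{-\alpha-1}e^{-t^2/2-xt}dt$. Set $\phi_1(y):=e^{-I(y)}D_\alpha(\sqrt{2m}(y-y_* ))$ and $\phi_2(y):=e^{-I(y)}D_\alpha(-\sqrt{2m}(y-y_* ))$. *)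

(* Defs.v *)
From HB Require Import structures.
From mathcomp Require Import all_boot all_order all_algebra.
From mathcomp Require Import all_classical all_reals all_analysis.

Set Implicit Arguments.
Unset Strict Implicit.
Unset Printing Implicit Defensive.

Import Order.TTheory GRing.Theory Num.Theory.
Import numFieldNormedType.Exports.

Local Open Scope classical_set_scope.
Local Open Scope ring_scope.

Section Defs.
Context {R : realType}.
Implicit Types (f g h : R -> R) (x y s al : R).

Local Notation mu := (@lebesgue_measure R).

(* Euler's integral; it is the Gamma function only for s > 0. *)
Definition Gamma s : R :=
  \int[mu]_(t in `]0, +oo[) (t `^ (s - 1) * expR (- t)).

(* The parabolic cylinder function of index al by its integral representation,
   which converges, and defines that function, only for al < 0. *)
Definition parabolic_cylinder al x : R :=
  expR (- (x ^+ 2 / 4)) / Gamma (- al) *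
  \int[mu]_(t in `]0, +oo[)
     (t `^ (- al - 1) * expR (- (t ^+ 2 / 2) - x * t)).

Definition wronskian f g y : R := f y * derive1 g y - derive1 f y * g y.

(* The integral from x to y with its usual sign, also when y < x. *)
Definition oriented_integral x y f : R :=
  if x <= y then \int[mu]_(z in `[x, y]) f z
  else - \int[mu]_(z in `[y, x]) f z.

(* h solves A h'' + b h' - c h + s = 0 on the whole line. *)
Definition solves_linear_ode2 (A : R) (b c : R -> R) s h : Prop :=
  [/\ forall y, derivable h y 1,
      forall y, derivable (derive1 h) y 1 &
      forall y, A * derive1n 2 h y + b y * derive1 h y - c y * h y + s = 0].

End Defs.

(* Main.v *)
Require Import Defs.
From HB Require Import structures.
From mathcomp Require Import all_boot all_order all_algebra.
From mathcomp Require Import all_classical all_reals all_analysis.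
From mathcomp Require Import measurable_realfun ring lra.

Set Implicit Arguments.
Unset Strict Implicit.
Unset Printing Implicit Defensive.

Import Order.TTheory GRing.Theory Num.Theory.
Import numFieldNormedType.Exports.

Local Open Scope classical_set_scope.
Local Open Scope ring_scope.

(* Substituting h = e^(-I) v turns the homogeneous equation into Weber's, and
   e^(-x^2/4) F_s(x), with F_s(x) = int_0^oo t^(s-1) e^(-t^2/2-xt) dt, solves
   Weber's equation because F_s' = -F_(s+1) and F_(s+2) = s F_s - x F_(s+1).

   No asymptotics of D_alpha are needed. With p = e^(2I), which is bounded, the
   equation reads (p h')' = p (q h - S) with q >= q0 > 0. Since phi_1 > 0 is
   bounded at +oo and p phi_1' is nondecreasing, phi_1' <= 0; symmetrically
   phi_2' >= 0. Hence p W is a positive constant w, and p phi_i <= (p phi_i')' / q0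
   gives int_y^oo p phi_1 <= - p phi_1' / q0 and int_(-oo)^y p phi_2 <= p phi_2' / q0.
   This yields the convergence of the improper integrals and
   0 < hstar <= S p W / (q0 w) = S / q0.
   The difference u of two bounded solutions vanishes because p (u^2)' is
   nondecreasing while u^2 is bounded. *)

(** * Derivation rules for explicit real functions *)

Section Derivatives.
Context {R : realType}.
Implicit Types (f g : R -> R) (x df dg c : R).

(** The rules are stated for functions written pointwise, so that the derivative of an explicit
    expression is assembled by unification. *)
Lemma is_derive1_cst c x : is_derive x (1 : R) (fun=> c) 0.
Proof. exact: is_derive_cst. Qed.

Lemma is_derive1D f g x df dg :
  is_derive x (1 : R) f df -> is_derive x (1 : R) g dg ->
  is_derive x (1 : R) (fun y => f y + g y) (df + dg).
Proof. exact: is_deriveD. Qed.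

Lemma is_derive1N f x df :
  is_derive x (1 : R) f df -> is_derive x (1 : R) (fun y => - f y) (- df).
Proof. exact: is_deriveN. Qed.

Lemma is_derive1B f g x df dg :
  is_derive x (1 : R) f df -> is_derive x (1 : R) g dg ->
  is_derive x (1 : R) (fun y => f y - g y) (df - dg).
Proof. exact: is_deriveB. Qed.

Lemma is_derive1M f g x df dg :
  is_derive x (1 : R) f df -> is_derive x (1 : R) g dg ->
  is_derive x (1 : R) (fun y => f y * g y) (f x * dg + df * g x).
Proof.
move=> hf hg; apply: (is_derive_eq (is_deriveM hf hg)).
by rewrite [df * _]mulrC.
Qed.

Lemma is_derive1Z c f x df :
  is_derive x (1 : R) f df -> is_derive x (1 : R) (fun y => c * f y) (c * df).
Proof. exact: is_deriveZ. Qed.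

Lemma is_derive1_expR f x df : is_derive x (1 : R) f df ->
  is_derive x (1 : R) (fun y => expR (f y)) (expR (f x) * df).
Proof. by move=> hf; exact: is_derive1_comp. Qed.

Lemma is_derive1_derive f x df : is_derive x (1 : R) f df -> derive1 f x = df.
Proof. by move=> hf; rewrite derive1E derive_val. Qed.

End Derivatives.

(** * The fundamental theorem of calculus on segments *)

Section Integration.
Context {R : realType}.
Implicit Types (f F : R -> R) (D : set R).
Local Notation mu := (@lebesgue_measure R).

Lemma is_derive_cvg f (x l : R) : is_derive x (1 : R) f l -> {for x, continuous f}.
Proof.
by move=> [df _]; apply: differentiable_continuous; exact/derivable1_diffP.
Qed.

Lemma integral_segment_FTC2 f F (a b : R) : a <= b ->
  (forall x, a <= x <= b -> {for x, continuous f}) ->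
  (forall x, a <= x <= b -> is_derive x (1 : R) F (f x)) ->
  (\int[mu]_(x in `[a, b]) (f x)%:E = (F b - F a)%:E)%E.
Proof.
rewrite le_eqVlt => /predU1P[<- _ _|ab cf dF].
  by rewrite set_itv1 integral_set1 subrr.
rewrite EFinB; apply: continuous_FTC2 => //.
- by apply: continuous_in_subspaceT => x /set_mem; rewrite /= in_itv/=; exact: cf.
- split.
  + by move=> x /subset_itv_oo_cc; rewrite in_itv/= => /dF [].
  + by apply: cvg_at_right_filter; apply: is_derive_cvg (dF _ _); rewrite lexx ltW.
  + by apply: cvg_at_left_filter; apply: is_derive_cvg (dF _ _); rewrite lexx ltW.
- move=> x /subset_itv_oo_cc; rewrite in_itv/= => /dF h.
  by rewrite derive1E derive_val.
Qed.

(** * Integrals over a domain exhausted by growing segments *)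

Section exhaustion.
Variables (D : set R) (a b : R^nat) (f F : R -> R).
Hypotheses (aD : {homo a : n m / (n <= m)%N >-> m <= n})
  (bD : {homo b : n m / (n <= m)%N >-> n <= m})
  (ab : forall n, a n <= b n)
  (DE : D = \bigcup_n `[a n, b n]%classic).
Hypotheses (cf : forall x, D x -> {for x, continuous f})
  (dF : forall x, D x -> is_derive x (1 : R) F (f x)).

Let sub_D n x : a n <= x <= b n -> D x.
Proof. by move=> h; rewrite DE; exists n => //=; rewrite in_itv. Qed.

Let mD : measurable D.
Proof. by rewrite DE; apply: bigcup_measurable => n _; exact: measurable_itv. Qed.

Let mono_itv : nondecreasing_seq (fun n => `[a n, b n]%classic).
Proof.
move=> n m nm; apply/subsetPset => x /=; rewrite !in_itv/= => /andP[h1 h2].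
by rewrite (le_trans (aD nm) h1) (le_trans h2 (bD nm)).
Qed.

Let mf : measurable_fun D f.
Proof.
rewrite DE; apply/measurable_fun_bigcup => n; first exact: measurable_itv.
apply/measurable_EFinP; apply: (measurable_int mu).
apply: continuous_compact_integrable; first exact: segment_compact.
apply: continuous_in_subspaceT => x /set_mem /= xab; apply: cf.
by apply: (@sub_D n); move: xab; rewrite in_itv.
Qed.

Let int_n n : (\int[mu]_(x in `[a n, b n]) (f x)%:E = (F (b n) - F (a n))%:E)%E.
Proof.
by apply: integral_segment_FTC2 => // x h; [apply: cf|apply: dF]; exact: sub_D h.
Qed.

(** Monotone convergence along the segments, where the integral is an increment of the primitive
    [F]; the bound on the increments yields integrability too. *)
Lemma ge0_integral_exhaustion (M : R) :
  (forall x, D x -> 0 <= f x) -> (forall n, F (b n) - F (a n) <= M) ->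
  mu.-integrable D (EFin \o f) /\ \int[mu]_(x in D) f x <= M.
Proof.
move=> f0 FM.
have le_M : (\int[mu]_(x in D) (f x)%:E <= M%:E)%E.
  have cvgI : (\int[mu]_(x in `[a n, b n]) (f x)%:E @[n --> \oo] -->
      \int[mu]_(x in D) (f x)%:E)%E.
    rewrite DE; apply: ge0_nondecreasing_set_cvg_integral => //.
    - move=> n; apply/measurable_EFinP; apply: measurable_funS mf => //.
      by move=> x xab; rewrite DE; exists n.
    - move=> n x; rewrite /= in_itv/= lee_fin => h; apply: f0.
      exact: (@sub_D n).
  apply: cvge_le cvgI; apply: nearW => n.
  by rewrite int_n lee_fin.
have f0' : (forall x, D x -> (0 <= (f x)%:E)%E).
  by move=> x Dx; rewrite lee_fin f0.
have If : mu.-integrable D (EFin \o f).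
  apply/integrableP; split; first exact/measurable_EFinP.
  under eq_integral => x /set_mem Dx do rewrite gee0_abs ?f0'//.
  exact: le_lt_trans le_M (ltry _).
by split => //; rewrite -lee_fin /Rintegral fineK//; exact: integrable_fin_num.
Qed.

(** Dominated convergence for the restrictions of [f] to the segments, with [|f|] as bound: [f] may
    change sign here, and at each point of [D] the restrictions eventually equal [f]. *)
Lemma integral_exhaustion (l : R) :
  mu.-integrable D (EFin \o f) -> F (b n) - F (a n) @[n --> \oo] --> l ->
  \int[mu]_(x in D) f x = l.
Proof.
move=> If cvgF.
have mfn n : measurable_fun D (fun x => ((f \_ `[a n, b n]) x)%:E).
  apply/measurable_EFinP/measurable_restrict => //.
  by apply: measurable_funS mf => //; exact: subIsetl.
have [||||_ _ cvgI] := @dominated_convergence _ _ _ mu D mD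
  (fun n x => ((f \_ `[a n, b n]) x)%:E) (EFin \o f) (fun x => `|f x|%:E) mfn.
- exact/measurable_EFinP.
- apply/aeW => x; rewrite [in X in X -> _]DE => -[N _] /= xN.
  apply: cvg_EFin; first exact: nearW.
  apply: cvg_near_cst; exists N => //= n /= Nn.
  rewrite patchE mem_set//=.
  by have /subsetPset := mono_itv Nn; exact.
- exact: integrable_abse If.
- apply/aeW => x n Dx; rewrite lee_fin patchE.
  by case: ifP => _; rewrite ?normr0 ?normr_ge0.
have cvgF' : (F (b n) - F (a n))%:E @[n --> \oo] --> l%:E by exact/cvg_EFin/cvgF/nearW.
rewrite /Rintegral -[RHS]/(fine l%:E); congr fine.
apply: cvg_unique cvgF'; [exact: ereal_hausdorff|].
apply: cvg_trans cvgI; apply: near_eq_cvg; apply: nearW => n /=.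
rewrite -int_n. rewrite -[in RHS](@setIidr _ D `[a n, b n]); last first.
  by move=> x /=; rewrite in_itv; exact: sub_D.
rewrite integral_mkcondr; apply: eq_integral => x _.
by rewrite !patchE; case: ifP.
Qed.
End exhaustion.
End Integration.

(** * Half-lines as increasing unions of segments *)

Section HalfLines.
Context {R : realType}.
Implicit Types (f F : R -> R).
Local Notation mu := (@lebesgue_measure R).

Lemma ge0_integral_itvcy f F (a M : R) : continuous f ->
  (forall x, is_derive x (1 : R) F (f x)) -> (forall x, a <= x -> 0 <= f x) ->
  (forall x, a <= x -> F x <= M) ->
  mu.-integrable `[a, +oo[ (EFin \o f) /\
  \int[mu]_(x in `[a, +oo[) f x <= M - F a.
Proof.
move=> cf dF f0 FM.
apply: (@ge0_integral_exhaustion _ _ (fun=> a) (fun n => a + n%:R) _ F) => //.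
- by move=> n m nm; rewrite lerD2l ler_nat.
- by move=> n; rewrite lerDl.
- by rewrite itv_bndy_bigcup_BRight.
- by move=> x _; exact: cf.
- by move=> x /=; rewrite in_itv/= andbT; exact: f0.
- by move=> n; rewrite lerD2r FM// lerDl.
Qed.

Lemma ge0_integral_itvNyc f F (a M : R) : continuous f ->
  (forall x, is_derive x (1 : R) F (f x)) -> (forall x, x <= a -> 0 <= f x) ->
  (forall x, x <= a -> M <= F x) ->
  mu.-integrable `]-oo, a] (EFin \o f) /\
  \int[mu]_(x in `]-oo, a]) f x <= F a - M.
Proof.
move=> cf dF f0 FM.
apply: (@ge0_integral_exhaustion _ _ (fun n => a - n%:R) (fun=> a) _ F) => //.
- by move=> n m nm; rewrite lerD2l lerN2 ler_nat.
- by move=> n; rewrite gerBl.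
- by rewrite itvNy_bnd_bigcup_BLeft.
- by move=> x _; exact: cf.
- by move=> n; rewrite lerD2l lerN2 FM// gerBl.
Qed.

Lemma itv0y_bigcup :
  `]0, +oo[%classic = \bigcup_n `[(n.+1%:R)^-1, n.+1%:R]%classic :> set R.
Proof.
apply/seteqP; split=> x /=.
  rewrite in_itv/= andbT => x0.
  (* Both [x] and [x^-1] are positive, so a bound on their sum bounds each. *)
  have [n xn] : exists n : nat, x + x^-1 < n.+1%:R.
    exists (Num.truncn (x + x^-1)).
    have /Num.Theory.truncn_itv/andP[] // : 0 <= x + x^-1.
    by rewrite addr_ge0// ?invr_ge0 ltW.
  exists n; rewrite //= in_itv/=.
  rewrite -[x in _ <= x]invrK lef_pV2 ?posrE ?invr_gt0//.
  have xi : 0 < x^-1 by rewrite invr_gt0.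
  by apply/andP; split; lra.
by move=> [n _]; rewrite /= !in_itv/= andbT => /andP[+ _]; exact: lt_le_trans.
Qed.

End HalfLines.

(** * The integrand of the parabolic cylinder function *)

Section Kernel.
Context {R : realType}.
Implicit Types (s x t : R).
Local Notation mu := (@lebesgue_measure R).

(** Indexed by [s = - al], as a Gamma integral is; each factor [t], hence each derivative in [x],
    raises [s] by one. [pcf_integral s] is the function [F_s] above. *)
Definition pcf_kernel s x t : R :=
  t `^ (s - 1) * expR (- (t ^+ 2 / 2) - x * t).

Definition pcf_integral s x : R := \int[mu]_(t in `]0, +oo[) pcf_kernel s x t.

Lemma continuous_powR (a t : R) : 0 < t -> {for t, continuous (fun t => t `^ a)}.
Proof. by move=> t0; exact: is_derive_cvg (is_derive1_powR a t0). Qed.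

(** The inequality [u <= 1 + u <= e^u] at [u = t / (2 s)], raised to the power [s]. *)
Lemma powR_le_expR s t : 0 < s -> 0 < t ->
  t `^ s <= (2 * s) `^ s * expR (t / 2).
Proof.
move=> s0 t0.
have s2 : 0 < 2 * s by rewrite mulr_gt0.
rewrite -[t in leLHS](divfK (lt0r_neq0 s2)).
have ts : 0 <= t / (2 * s) by rewrite ltW// divr_gt0.
rewrite (powRM _ ts (ltW s2)) [leLHS]mulrC ler_wpM2l ?powR_ge0//.
rewrite (_ : t / 2 = (t / (2 * s)) * s); last by field; lra.
rewrite expRM ge0_ler_powR ?nnegrE ?expR_ge0 ?(ltW s0)//.
by rewrite (le_trans _ (expR_ge1Dx _))// lerDr.
Qed.

(* Integrable because -(1 + t^s)^-1 is a bounded monotone primitive. *)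
Lemma integrable_powR_bump s : 0 < s ->
  mu.-integrable `]0, +oo[
    (EFin \o (fun t => s * t `^ (s - 1) / (1 + t `^ s) ^+ 2)).
Proof.
move=> s0.
have p t : 0 < 1 + t `^ s :> R by rewrite ltr_pwDl// powR_ge0.
apply: (@ge0_integral_exhaustion _ _ (fun n => n.+1%:R^-1) (fun n => n.+1%:R) _
  (fun t => - (1 + t `^ s)^-1) _ _ _ itv0y_bigcup _ _ 1 _ _).1.
- by move=> n m nm; rewrite lef_pV2 ?posrE// ler_nat.
- by move=> n m nm; rewrite ler_nat.
- by move=> n; rewrite (@le_trans _ _ 1)// ?ler1n// invf_le1// ler1n.
- move=> t; rewrite /= in_itv/= andbT => t0.
  apply: cvgM; first by apply: cvgM; [exact: cvg_cst|exact: continuous_powR].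
  apply: cvgV; first by rewrite expf_neq0// gt_eqF.
  have c : {for t, continuous (fun t => 1 + t `^ s)}.
    by apply: cvgD; [exact: cvg_cst|exact: continuous_powR].
  exact: (cvgM c c).
- move=> t; rewrite /= in_itv/= andbT => t0.
  have d1 : is_derive t (1 : R) (fun t => 1 + t `^ s) (s * t `^ (s - 1)).
    apply: (is_derive_eq (is_derive1D (is_derive1_cst 1 t) (is_derive1_powR s t0))).
    by rewrite add0r.
  have /is_derive1N/is_derive_eq :=
    @is_deriveV _ (fun t => 1 + t `^ s) t _ _ (lt0r_neq0 (p t)) d1; apply.
  by rewrite /GRing.scale/= mulNr opprK mulrC.
- by move=> t _; rewrite divr_ge0 ?exprn_ge0 ?mulr_ge0 ?powR_ge0 ?ltW.
- move=> n; rewrite opprK.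
  have h : (1 + n.+1%:R^-1 `^ s)^-1 <= 1 :> R by rewrite invf_le1 ?lerDl ?powR_ge0.
  have h2 : 0 <= (1 + n.+1%:R `^ s)^-1 :> R by rewrite invr_ge0 ltW.
  lra.
Qed.

Lemma measurable_pcf_kernel s x : measurable_fun setT (pcf_kernel s x).
Proof.
apply: measurable_funM; first exact: measurable_powR.
apply: measurableT_comp => //; apply: measurable_funB.
  by apply: measurableT_comp => //; apply: measurable_funM => //; exact: measurable_funX.
exact: measurable_funM.
Qed.

Lemma pcf_kernel_ge0 s x t : 0 <= pcf_kernel s x t.
Proof. by rewrite mulr_ge0 ?powR_ge0 ?expR_ge0. Qed.

(** From [t^s <= (2 s)^s e^(t/2)] follows [(1 + t^s) e^(-t/2) <= 1 + (2 s)^s]; squaring compares the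
    integrand with the integrable bump, and [C] collects the constants. *)
Lemma integrable_powR_expRN s : 0 < s ->
  mu.-integrable `]0, +oo[ (EFin \o (fun t => t `^ (s - 1) * expR (- t))).
Proof.
move=> s0.
pose C := (1 + (2 * s) `^ s) ^+ 2 / s.
have C0 : 0 <= C by rewrite divr_ge0 ?exprn_ge0 ?addr_ge0 ?powR_ge0 ?ltW.
have iC : mu.-integrable `]0, +oo[
    (fun t => (C%:E * (EFin \o (fun t => s * t `^ (s - 1) / (1 + t `^ s) ^+ 2)%R) t)%E).
  by apply: integrableZl => //; exact: integrable_powR_bump.
apply: le_integrable iC => //.
  apply/measurable_EFinP; apply: measurable_funM.
    by apply: measurable_funTS; exact: measurable_powR.
  apply: measurableT_comp => //; exact: measurable_funTS.
move=> t; rewrite /= in_itv/= andbT => t0.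
have p : 0 < 1 + t `^ s :> R by rewrite ltr_pwDl// powR_ge0.
have q : 0 < t `^ (s - 1) by rewrite powR_gt0.
rewrite lee_fin !ger0_norm; last 2 first.
- by rewrite mulr_ge0// divr_ge0 ?exprn_ge0 ?mulr_ge0 ?powR_ge0 ?(ltW p) ?(ltW s0).
- by rewrite mulr_ge0 ?expR_ge0 ?powR_ge0.
rewrite /C (_ : _ / s * _ =
  t `^ (s - 1) * ((1 + (2 * s) `^ s) / (1 + t `^ s)) ^+ 2); last first.
  by field; rewrite !gt_eqF.
rewrite ler_pM2l// (_ : expR (- t) = expR (- (t / 2)) ^+ 2); last first.
  by rewrite -expRM_natl; congr expR; field.
apply: lerXn2r; rewrite ?nnegrE ?expR_ge0//.
  by rewrite divr_ge0 ?addr_ge0 ?powR_ge0.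
rewrite expRN ler_pdivlMr// ler_pdivrMl ?expR_gt0// mulrDr mulr1 [leRHS]addrC mulrC.
have := powR_le_expR s0 t0.
have : 1 <= expR (t / 2) by rewrite -expR0 ler_expR divr_ge0// ltW.
lra.
Qed.

(** Completing the square, [-t^2/2 - x t <= (1 - x)^2/2 - t], which reduces every real [x] to the
    Gamma integrand. *)
Lemma integrable_pcf_kernel s x : 0 < s ->
  mu.-integrable `]0, +oo[ (EFin \o pcf_kernel s x).
Proof.
move=> s0.
have iC : mu.-integrable `]0, +oo[ (fun t => ((expR ((1 - x) ^+ 2 / 2))%:E *
    (EFin \o (fun t => t `^ (s - 1) * expR (- t))%R) t)%E).
  by apply: integrableZl => //; exact: integrable_powR_expRN.
apply: le_integrable iC => //.
  by apply/measurable_EFinP/measurable_funTS; exact: measurable_pcf_kernel.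
move=> t; rewrite /= in_itv/= andbT => t0.
rewrite lee_fin !ger0_norm ?pcf_kernel_ge0 ?mulr_ge0 ?expR_ge0 ?powR_ge0//.
rewrite mulrCA ler_wpM2l ?powR_ge0// -expRD ler_expR.
have := sqr_ge0 (t - (1 - x)); rewrite !expr2; lra.
Qed.

End Kernel.

(** * Positivity, derivative and recurrence of the integral *)

Section KernelIntegral.
Context {R : realType}.
Implicit Types (s x t : R) (f : R -> R).
Local Notation mu := (@lebesgue_measure R).

Let mpos : measurable (`]0, +oo[%classic : set (measurableTypeR R)).
Proof. exact: measurable_itv. Qed.

(** A vanishing integral would make [f] zero almost everywhere, so the half-line would lie in a null
    set, although its measure is infinite. *)
Lemma Rintegral_itv0y_gt0 f : mu.-integrable `]0, +oo[ (EFin \o f) ->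
  (forall t, 0 < t -> 0 < f t) -> 0 < \int[mu]_(t in `]0, +oo[) f t.
Proof.
move=> If f0; rewrite lt0r; apply/andP; split; last first.
  by apply: Rintegral_ge0 => t; rewrite /= in_itv/= andbT => /f0/ltW.
apply/negP => /eqP If0.
have mf : measurable_fun (`]0, +oo[ : set R) (EFin \o f) by exact: measurable_int If.
have : (\int[mu]_(t in `]0%R, +oo[) `|(f t)%:E| = 0)%E.
  transitivity (\int[mu]_(t in `]0%R, +oo[) (f t)%:E)%E.
    apply: eq_integral => t /set_mem; rewrite /= in_itv/= andbT => /f0/ltW h.
    by rewrite ger0_norm.
  have := integrable_fin_num mpos If.
  by move=> /fineK => <-; congr EFin; exact: If0.
move/(ae_eq_integral_abs _ mpos mf) => [N [mN N0 subN]].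
have : (mu `]0%R, +oo[ <= mu N)%E.
  apply: le_measure; rewrite ?inE//.
  move=> t t0; apply: subN => /= h; move: t0 (h t0).
  rewrite /= in_itv/= andbT => /f0 ft [] E.
  by rewrite E ltxx in ft.
by rewrite N0 lebesgue_measure_itv/= ltry.
Qed.

Lemma pcf_integral_gt0 s x : 0 < s -> 0 < pcf_integral s x.
Proof.
move=> s0; apply: Rintegral_itv0y_gt0; first exact: integrable_pcf_kernel.
by move=> t t0; rewrite mulr_gt0 ?powR_gt0 ?expR_gt0.
Qed.

Lemma Gamma_gt0 s : 0 < s -> 0 < Gamma s.
Proof.
move=> s0; apply: Rintegral_itv0y_gt0; first exact: integrable_powR_expRN.
by move=> t t0; rewrite mulr_gt0 ?powR_gt0 ?expR_gt0.
Qed.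

Lemma pcf_kernelS s x t : 0 < t ->
  pcf_kernel (s + 1) x t = t * pcf_kernel s x t.
Proof.
move=> t0; rewrite /pcf_kernel (_ : s + 1 - 1 = s - 1 + 1); last by ring.
rewrite (@powRD _ t (s - 1) 1); last by rewrite (gt_eqF t0) implybT.
by rewrite powRr1 ?(ltW t0)// mulrA [t * _]mulrC.
Qed.

Lemma is_derive_pcf_kernel s x t :
  is_derive x (1 : R) (pcf_kernel s ^~ t) (- t * pcf_kernel s x t).
Proof.
have d : is_derive x (1 : R) (fun x => - (t ^+ 2 / 2) - x * t) (- t).
  apply: (is_derive_eq (is_derive1B (is_derive1_cst _ x)
    (is_derive1M (is_derive_id x 1) (is_derive1_cst t x)))).
  by rewrite mulr0 mul1r !add0r.
apply: (is_derive_eq (is_derive1Z (t `^ (s - 1)) (is_derive1_expR d))).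
by rewrite mulrA mulrC.
Qed.

(** Differentiation under the integral sign. For [y] in []x - 1, x + 1[] the derivative is dominated
    by the kernel of index [s + 1] at [x - 1], because [e^(-yt)] decreases in [y]. *)
Lemma is_derive_pcf_integral s x : 0 < s ->
  is_derive x (1 : R) (pcf_integral s) (- pcf_integral (s + 1) x).
Proof.
move=> s0.
have s1 : 0 < s + 1 by rewrite addr_gt0.
have xI : `]x - 1, x + 1[%classic x by rewrite /= in_itv/=; apply/andP; split; lra.
have df y t : `]x - 1, x + 1[%classic y -> `]0, +oo[%classic t ->
    derivable (pcf_kernel s ^~ t) y 1.
  by move=> _ _; have [] := is_derive_pcf_kernel s y t.
have d1 y t : partial1of2 (pcf_kernel s) y t = - t * pcf_kernel s y t.
  exact: is_derive1_derive (is_derive_pcf_kernel s y t).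
have ub y t : `]x - 1, x + 1[%classic y -> `]0, +oo[%classic t ->
    `|partial1of2 (pcf_kernel s) y t| <= pcf_kernel (s + 1) (x - 1) t.
  rewrite /= !in_itv/= andbT => /andP[y1 _] t0.
  rewrite d1 normrM normrN (gtr0_norm t0) ger0_norm ?pcf_kernel_ge0//.
  rewrite -pcf_kernelS// ler_wpM2l ?powR_ge0// ler_expR lerD2l lerN2.
  by rewrite ler_wpM2r ?(ltW t0) ?(ltW y1).
have intf y : `]x - 1, x + 1[%classic y ->
    mu.-integrable `]0, +oo[ (EFin \o pcf_kernel s y).
  by move=> _; exact: integrable_pcf_kernel.
have D := @derivable_under_integral _ _ _ mu _ _ mpos _ _ _ xI intf
  df _ (fun t => pcf_kernel_ge0 (s + 1) (x - 1) t)
  (integrable_pcf_kernel (x - 1) s1) ub.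
have E := @differentiation_under_integral _ _ _ mu _ _ mpos _ _ _ xI
  intf df _ (fun t => pcf_kernel_ge0 (s + 1) (x - 1) t)
  (integrable_pcf_kernel (x - 1) s1) ub.
apply: DeriveDef; first exact: D.
rewrite -derive1E E -[RHS]mulN1r -RintegralZl//; last exact: integrable_pcf_kernel.
apply: eq_Rintegral => t /set_mem; rewrite /= in_itv/= andbT => t0.
by rewrite d1 pcf_kernelS// mulNr mulN1r.
Qed.

(* The derivative of [t^s e^(-t^2/2 - xt)] integrates to [0]. *)
Lemma pcf_integral_rec s x : 0 < s ->
  pcf_integral (s + 2) x = s * pcf_integral s x - x * pcf_integral (s + 1) x.
Proof.
move=> s0.
have s1 : 0 < s + 1 by rewrite addr_gt0.
have s2 : 0 < s + 2 by rewrite addr_gt0.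
(* The product rule for [H] gives [s t^(s-1) - (t + x) t^s] times the exponential; [h] writes this
   in kernels of index [s], [s + 2] and [s + 1]. *)
pose h t := s * pcf_kernel s x t - (pcf_kernel (s + 2) x t + x * pcf_kernel (s + 1) x t).
pose H t := t `^ s * expR (- (t ^+ 2 / 2) - x * t).
have dH t : 0 < t -> is_derive t (1 : R) H (h t).
  move=> t0.
  have d : is_derive t (1 : R) (fun t => - (t ^+ 2 / 2) - x * t) (- t - x).
    apply: (is_derive_eq (is_derive1B (is_derive1N (is_derive1M
     (is_derive1M (is_derive_id t 1) (is_derive_id t 1)) (is_derive1_cst _ t)))
     (is_derive1Z x (is_derive_id t 1)))).
    by field.
  apply: (is_derive_eq (is_derive1M (is_derive1_powR s t0) (is_derive1_expR d))).
  rewrite /h (_ : s + 2 = s + 1 + 1); last by ring.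
  rewrite !pcf_kernelS// /pcf_kernel.
  rewrite (_ : t `^ s = t * t `^ (s - 1)); first by ring.
  rewrite -[X in _ `^ X = _](subrK 1 s) (@powRD _ t (s - 1) 1).
    by rewrite powRr1 ?(ltW t0)// mulrC.
  by rewrite (gt_eqF t0) implybT.
have cK s' t : 0 < t -> {for t, continuous (pcf_kernel s' x)}.
  move=> t0; apply: cvgM; first exact: continuous_powR.
  apply: (cvg_comp _ expR); last exact: continuous_expR.
  apply: cvgB; last by apply: cvgM; [exact: cvg_cst|exact: cvg_id].
  apply: cvgN; apply: cvgM; last exact: cvg_cst.
  exact: exprn_continuous.
have ch t : 0 < t -> {for t, continuous h}.
  move=> t0; apply: cvgB; first by apply: cvgM; [exact: cvg_cst|exact: cK].
  apply: cvgD; first exact: cK.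
  by apply: cvgM; [exact: cvg_cst|exact: cK].
have Is c s' : 0 < s' ->
    mu.-integrable `]0, +oo[ (EFin \o (fun t => c * pcf_kernel s' x t)).
  move=> s'0; have := integrableZl mpos c (integrable_pcf_kernel x s'0).
  by apply.
have Is1 s' : 0 < s' ->
    mu.-integrable `]0, +oo[ (EFin \o (fun t => pcf_kernel s' x t)).
  exact: integrable_pcf_kernel.
have I2 : mu.-integrable `]0, +oo[
    (EFin \o (fun t => pcf_kernel (s + 2) x t + x * pcf_kernel (s + 1) x t)).
  have := integrableD mpos (Is1 _ s2) (Is x _ s1).
  by apply.
have Ih : mu.-integrable `]0, +oo[ (EFin \o h).
  have := integrableB mpos (Is s _ s0) I2.
  by apply.
have intE : \int[mu]_(t in `]0, +oo[) h t =
    s * pcf_integral s x - (pcf_integral (s + 2) x + x * pcf_integral (s + 1) x).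
  rewrite RintegralB//; last exact: Is.
  rewrite RintegralD//; [|exact: Is1|exact: Is].
  by rewrite !RintegralZl//; exact: Is1.
have : \int[mu]_(t in `]0, +oo[) h t = 0.
  apply: (@integral_exhaustion _ _ (fun n => n.+1%:R^-1) (fun n => n.+1%:R) _ H
    _ _ _ itv0y_bigcup) => //.
  - by move=> n m nm; rewrite lef_pV2 ?posrE// ler_nat.
  - by move=> n m nm; rewrite ler_nat.
  - by move=> n; rewrite (@le_trans _ _ 1)// ?ler1n// invf_le1// ler1n.
  - by move=> t; rewrite /= in_itv/= andbT; exact: ch.
  - by move=> t; rewrite /= in_itv/= andbT; exact: dH.
  - rewrite -[0]subr0; apply: cvgB.
    (* At the upper end [t = n + 1], [t^s <= (2 s)^s e^(t/2)], and completing the square in the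
       exponent leaves a constant times [e^(-t)]. *)
    + apply: (@squeeze_cvgr _ _ _ _ (fun=> 0)
        (fun n => (2 * s) `^ s * expR ((x - 3 / 2) ^+ 2 / 2) * expR (- n.+1%:R))).
      * apply: nearW => n; rewrite mulr_ge0 ?powR_ge0 ?expR_ge0//=.
        rewrite (le_trans (ler_wpM2r (expR_ge0 _) (powR_le_expR s0 _)))//.
        rewrite -!mulrA ler_wpM2l ?powR_ge0// -!expRD ler_expR.
        have := sqr_ge0 (n.+1%:R + (x - 3 / 2)); rewrite !expr2; lra.
      * exact: cvg_cst.
      * rewrite -[X in _ --> X](mulr0 ((2 * s) `^ s * expR ((x - 3 / 2) ^+ 2 / 2))).
        apply: cvgM; first exact: cvg_cst.
        by rewrite (cvg_shiftS (fun n => expR (- n%:R))); exact: cvgn_expR.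
    (* At the lower end [t = 1/(n+1)], the exponential is at most [e^(x^2/2)] and [t^s] tends to [0]
       since [s > 0]. *)
    + apply: (@squeeze_cvgr _ _ _ _ (fun=> 0)
        (fun n => n.+1%:R^-1 `^ s * expR (x ^+ 2 / 2))).
      * apply: nearW => n; rewrite mulr_ge0 ?powR_ge0 ?expR_ge0//=.
        rewrite ler_wpM2l ?powR_ge0// ler_expR.
        move: n.+1%:R^-1 => u; have := sqr_ge0 (u + x); rewrite !expr2; lra.
      * exact: cvg_cst.
      * rewrite -[X in _ --> X](mul0r (expR (x ^+ 2 / 2))).
        apply: cvgM; last exact: cvg_cst.
        have /cvg_at_rightP := powR_cvg0 s0; apply; split; last exact: cvg_harmonic.
        by move=> n; rewrite invr_gt0.
by rewrite intE; lra.
Qed.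

End KernelIntegral.

(** * Monotonicity from derivatives and the sign of a flux *)

Section MeanValue.
Context {R : realType}.
Implicit Types (f df g dg p : R -> R).

Lemma is_derive_ge_slope f df (a c y : R) :
  (forall x, is_derive x (1 : R) f (df x)) ->
  (forall x, a <= x -> c <= df x) -> a <= y -> c * (y - a) <= f y - f a.
Proof.
move=> hf cdf; rewrite le_eqVlt => /predU1P[->|ay]; first by rewrite !subrr mulr0.
have [x|x xay ->] := @MVT _ f df a y ay (fun x _ => hf x).
  by apply: continuous_subspaceT => z; exact: is_derive_cvg.
apply: ler_wpM2r; first by rewrite subr_ge0 ltW.
by apply: cdf; move: xay; rewrite in_itv => /andP[/ltW].
Qed.

Lemma is_derive_ge0_homo f df : (forall x, is_derive x (1 : R) f (df x)) ->
  (forall x, 0 <= df x) -> {homo f : x y / x <= y}.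
Proof.
move=> hf df0 x y xy; rewrite -subr_ge0.
by have := is_derive_ge_slope hf (fun z _ => df0 z) xy; rewrite mul0r.
Qed.

(* If the flux [p * dg] were positive somewhere it would stay bounded away from
   [0], so that [g] would grow at least linearly. *)
Lemma flux_le0 p g dg (M a K : R) :
  (forall y, 0 < p y) -> (forall y, p y <= M) ->
  (forall y, is_derive y (1 : R) g (dg y)) ->
  {homo (fun y => p y * dg y) : x y / x <= y} ->
  (forall y, a <= y -> g y <= K) -> forall y, dg y <= 0.
Proof.
move=> p0 pM hg flux gK y; rewrite leNgt; apply/negP => dgy.
have M0 : 0 < M := lt_le_trans (p0 y) (pM y).
(* Right of [y] the flux is at least [p y * dg y], and [p <= M] turns this into the lower bound [c]
   for the slope. *)
pose c := p y * dg y / M.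
have c0 : 0 < c by rewrite divr_gt0 ?mulr_gt0.
have cdg x : y <= x -> c <= dg x.
  move=> /flux /= h.
  have dgx : 0 < dg x by rewrite -(pmulr_rgt0 _ (p0 x)) (lt_le_trans _ h) ?mulr_gt0.
  rewrite ler_pdivrMr// (le_trans h)// mulrC.
  by rewrite ler_wpM2l ?(ltW dgx).
(* Far enough right to lie beyond [a] and for growth at slope [c] to exceed [K - g y]. *)
pose z := y + `|a - y| + (`|K - g y| + 1) / c.
have yz : y <= z by rewrite /z -addrA lerDl addr_ge0// divr_ge0 ?addr_ge0 ?(ltW c0).
have az : a <= z.
  have := ler_norm (a - y).
  have : 0 <= (`|K - g y| + 1) / c by rewrite divr_ge0 ?addr_ge0 ?(ltW c0).
  rewrite /z; lra.
have := is_derive_ge_slope hg cdg yz.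
have : c * (z - y) = c * `|a - y| + (`|K - g y| + 1).
  by rewrite /z; field; rewrite gt_eqF.
have := gK _ az.
have : 0 <= c * `|a - y| by rewrite mulr_ge0 ?(ltW c0).
have := ler_norm (K - g y).
lra.
Qed.

Lemma is_derive1_opp f df (y : R) : is_derive (- y) (1 : R) f (df (- y)) ->
  is_derive y (1 : R) (fun y => f (- y)) (- df (- y)).
Proof.
move=> hf; have := @is_derive1_comp _ f -%R y _ _ hf (is_derive1N (is_derive_id y 1)).
by move/is_derive_eq; apply; rewrite mulrN1.
Qed.

(** Reflection [y -> - y] reduces this to the other end: the flux of the reflected [g] is the
    reflected flux with opposite sign, hence again nondecreasing. *)
Lemma flux_ge0 p g dg (M a K : R) :
  (forall y, 0 < p y) -> (forall y, p y <= M) ->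
  (forall y, is_derive y (1 : R) g (dg y)) ->
  {homo (fun y => p y * dg y) : x y / x <= y} ->
  (forall y, y <= a -> g y <= K) -> forall y, 0 <= dg y.
Proof.
move=> p0 pM hg flux gK y.
rewrite -oppr_le0 -[y]opprK.
apply: (@flux_le0 (p \o -%R) (g \o -%R) (fun y => - dg (- y)) M (- a) K) => //=.
- by move=> x; exact: is_derive1_opp.
- by move=> u v uv /=; rewrite !mulrN lerN2; apply: flux; rewrite lerN2.
- by move=> x ax; apply: gK; rewrite lerNl.
Qed.

Lemma oriented_integralE f F (x y : R) : continuous f ->
  (forall z, is_derive z (1 : R) F (f z)) -> oriented_integral x y f = F y - F x.
Proof.
move=> cf hF; rewrite /oriented_integral; case: leP => [xy|/ltW yx].
  by rewrite /Rintegral (integral_segment_FTC2 xy (fun z _ => cf z) (fun z _ => hF z)).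
by rewrite /Rintegral (integral_segment_FTC2 yx (fun z _ => cf z) (fun z _ => hF z)) /= opprB.
Qed.

End MeanValue.

(** * The normalised equation [h'' + B h' - q h + S = 0] *)

Section SturmLiouville.
Context {R : realType}.
Variables (p B q : R -> R) (q0 M : R).
Hypotheses (p_gt0 : forall y, 0 < p y) (p_le : forall y, p y <= M)
  (dp : forall y, is_derive y (1 : R) p (B y * p y))
  (q0_gt0 : 0 < q0) (q_ge : forall y, q0 <= q y).
Implicit Types (h dh g dg : R -> R) (S T : R).

(* As [p' = B p], this is [(p h')' = p (q h - S)]. *)
Definition sl_solution S h dh :=
  (forall y, is_derive y (1 : R) h (dh y)) /\
  (forall y, is_derive y (1 : R) dh (q y * h y - B y * dh y - S)).

Lemma is_derive_flux S h dh y : sl_solution S h dh ->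
  is_derive y (1 : R) (fun y => p y * dh y) (p y * (q y * h y - S)).
Proof.
move=> [hh hdh]; apply: (is_derive_eq (is_derive1M (dp y) (hdh y))); ring.
Qed.

(** Lagrange's identity. With [S = T = 0] it is Abel's formula for the Wronskian; with one source
    zero it drives the variation of constants. *)
Lemma is_derive_pW S T h dh g dg y : sl_solution S h dh -> sl_solution T g dg ->
  is_derive y (1 : R) (fun y => p y * (h y * dg y - dh y * g y))
    (p y * (S * g y - T * h y)).
Proof.
move=> [hh hdh] [hg hdg].
apply: (is_derive_eq (is_derive1M (dp y)
  (is_derive1B (is_derive1M (hh y) (hdg y)) (is_derive1M (hdh y) (hg y))))).
ring.
Qed.

Lemma sl_solutionB S T h dh g dg : sl_solution S h dh -> sl_solution T g dg ->
  sl_solution (S - T) (fun y => h y - g y) (fun y => dh y - dg y).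
Proof.
move=> [hh hdh] [hg hdg]; split=> y; first exact: is_derive1B.
apply: (is_derive_eq (is_derive1B (hdh y) (hdg y))); ring.
Qed.

(* [p (u^2)'] is nondecreasing and [u^2] is bounded at both ends, so
   [(u^2)' = 0]. *)
Lemma bounded_homogeneous_eq0 u du (K : R) : sl_solution 0 u du ->
  (forall y, `|u y| <= K) -> forall y, u y = 0.
Proof.
move=> su uK.
have [hu _] := su.
have dg y : is_derive y (1 : R) (fun y => u y * u y) (2 * (u y * du y)).
  apply: (is_derive_eq (is_derive1M (hu y) (hu y))); ring.
have dflux y : is_derive y (1 : R) (fun y => p y * (2 * (u y * du y)))
    (2 * (p y * (du y ^+ 2 + q y * u y ^+ 2))).
  (* Regrouped around the flux [p * du], whose derivative the equation gives. *)
  have -> : (fun y => p y * (2 * (u y * du y))) = (fun y => 2 * (u y * (p y * du y))).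
    by apply/funext => z; ring.
  apply: (is_derive_eq (is_derive1Z 2 (is_derive1M (hu y) (is_derive_flux y su)))).
  ring.
have q_gt0 y : 0 < q y := lt_le_trans q0_gt0 (q_ge y).
have flux : {homo (fun y => p y * (2 * (u y * du y))) : x y / x <= y}.
  apply: is_derive_ge0_homo dflux _ => y.
  rewrite mulr_ge0// mulr_ge0 ?(ltW (p_gt0 _))// addr_ge0 ?sqr_ge0//.
  by rewrite mulr_ge0 ?sqr_ge0 ?(ltW (q_gt0 _)).
have uu y : u y * u y <= K ^+ 2.
  have K0 : 0 <= K := le_trans (normr_ge0 _) (uK y).
  by rewrite -expr2 -[leLHS]ger0_norm ?sqr_ge0// normrX lerXn2r ?nnegrE.
have dg0 y : 2 * (u y * du y) = 0.
  apply/eqP; rewrite eq_le.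
  rewrite (flux_le0 p_gt0 p_le dg flux (a := 0) (fun y _ => uu y)).
  by rewrite (flux_ge0 p_gt0 p_le dg flux (a := 0) (fun y _ => uu y)).
move=> y.
have : (fun y => p y * (2 * (u y * du y))) = (fun=> 0).
  by apply/funext => z; rewrite dg0 mulr0.
(* The flux of [u^2] is identically zero, hence so is its derivative [2 p (u'^2 + q u^2)], a sum of
   nonnegative terms. *)
move=> E; have := is_derive1_derive (dflux y); rewrite E derive1_cst => /esym/eqP.
rewrite mulf_eq0 pnatr_eq0/= mulf_eq0 gt_eqF//= => /eqP sum0.
have qu : 0 <= q y * u y ^+ 2 by rewrite mulr_ge0 ?sqr_ge0 ?(ltW (q_gt0 _)).
have /eqP : q y * u y ^+ 2 = 0 by have := sqr_ge0 (du y); lra.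
by rewrite mulf_eq0 gt_eqF//= sqrf_eq0 => /eqP.
Qed.

End SturmLiouville.

(** * A positive pair of homogeneous solutions bounded at opposite ends *)

Section DecayingPair.
Context {R : realType}.
Local Notation mu := (@lebesgue_measure R).
Variables (p B q : R -> R) (q0 M : R).
Hypotheses (p_gt0 : forall y, 0 < p y) (p_le : forall y, p y <= M)
  (dp : forall y, is_derive y (1 : R) p (B y * p y))
  (q0_gt0 : 0 < q0) (q_ge : forall y, q0 <= q y) (cq : continuous q).
Variables (phi1 dphi1 phi2 dphi2 : R -> R) (a1 a2 K1 K2 : R).
Hypotheses (s1 : sl_solution B q 0 phi1 dphi1) (s2 : sl_solution B q 0 phi2 dphi2)
  (phi1_gt0 : forall y, 0 < phi1 y) (phi2_gt0 : forall y, 0 < phi2 y)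
  (phi1_le : forall y, a1 <= y -> phi1 y <= K1)
  (phi2_le : forall y, y <= a2 -> phi2 y <= K2).

Let W y := phi1 y * dphi2 y - dphi1 y * phi2 y.
Let J1 y := \int[mu]_(z in `[y, +oo[) (phi1 z / W z).
Let J2 y := \int[mu]_(z in `]-oo, y]) (phi2 z / W z).

Let q_gt0 y : 0 < q y. Proof. exact: lt_le_trans q0_gt0 (q_ge y). Qed.

(** The derivative of the flux is [p q phi], which is positive. *)
Let flux_homo phi dphi : sl_solution B q 0 phi dphi -> (forall y, 0 < phi y) ->
  {homo (fun y => p y * dphi y) : x y / x <= y}.
Proof.
move=> sphi phi0; apply: (is_derive_ge0_homo (fun y => is_derive_flux dp y sphi)) => y.
by rewrite subr0 !mulr_ge0// ltW.
Qed.

Let dphi1_le0 y : dphi1 y <= 0.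
Proof. exact: flux_le0 p_gt0 p_le s1.1 (flux_homo s1 phi1_gt0) phi1_le y. Qed.

Let dphi2_ge0 y : 0 <= dphi2 y.
Proof. exact: flux_ge0 p_gt0 p_le s2.1 (flux_homo s2 phi2_gt0) phi2_le y. Qed.

Let w := p 0 * W 0.

(** Lagrange's identity without sources; the base point [0] in [w] is arbitrary. *)
Let pW y : p y * W y = w.
Proof.
apply: (@is_derive_0_is_cst _ (fun y => p y * W y)) => z.
by apply: (is_derive_eq (is_derive_pW dp z s1 s2)); rewrite !mul0r subr0 mulr0.
Qed.

Let W_ge0 y : 0 <= W y.
Proof.
rewrite addr_ge0 ?oppr_ge0 ?mulr_ge0 ?mulr_le0_ge0 ?dphi1_le0 ?dphi2_ge0//; exact: ltW.
Qed.

(** If [w] vanished, so would both nonnegative terms of [W], hence [dphi1]; the equation for [phi1]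
    at [0] would then give [q 0 * phi1 0 = 0], against positivity. *)
Let w_gt0 : 0 < w.
Proof.
rewrite lt_neqAle -[leRHS](pW 0) mulr_ge0 ?(ltW (p_gt0 _)) ?W_ge0// andbT.
apply/eqP => /esym w0.
have d0 y : dphi1 y = 0.
  have /eqP : p y * W y = 0 by rewrite pW.
  rewrite mulf_eq0 gt_eqF//= /W => /eqP W0.
  have h1 : 0 <= phi1 y * dphi2 y by rewrite mulr_ge0 ?dphi2_ge0 ?(ltW (phi1_gt0 _)).
  have h2 : dphi1 y * phi2 y <= 0 by rewrite mulr_le0_ge0 ?dphi1_le0 ?(ltW (phi2_gt0 _)).
  have /eqP : dphi1 y * phi2 y = 0 by lra.
  by rewrite mulf_eq0 [phi2 y == 0]gt_eqF// orbF => /eqP.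
have E : dphi1 = (fun=> 0) by apply/funext.
have := is_derive1_derive (s1.2 0); rewrite E derive1_cst mulr0 !subr0 => /esym/eqP.
by rewrite mulf_eq0 !gt_eqF.
Qed.

Lemma pair_wronskian_gt0 y : 0 < W y.
Proof. by rewrite -(pmulr_rgt0 _ (p_gt0 y)) pW. Qed.

Let WE y : W y = w / p y.
Proof. by rewrite -(pW y) mulrAC divff ?mul1r// gt_eqF. Qed.

Let divW x y : x / W y = p y * x / w.
Proof. by rewrite WE invf_div mulrA [x * _]mulrC. Qed.

Let cW : continuous W.
Proof.
move=> y; apply: cvgB; apply: cvgM.
- exact: is_derive_cvg (s1.1 y).
- exact: is_derive_cvg (s2.2 y).
- exact: is_derive_cvg (s1.2 y).
- exact: is_derive_cvg (s2.1 y).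
Qed.

Let cphiW phi dphi : sl_solution B q 0 phi dphi -> continuous (fun z => phi z / W z).
Proof.
move=> sphi z; apply: cvgM; first exact: is_derive_cvg (sphi.1 z).
by apply: cvgV; [rewrite gt_eqF// pair_wronskian_gt0|exact: cW].
Qed.

(** A majorant with a known primitive: [phi / W = p phi / w] is at most [p q phi / (q0 w)], the
    derivative of [p dphi / (q0 w)]. The [- 0] keeps the form of [is_derive_flux] for a zero
    source. *)
Let dominating phi dphi (c := (q0 * w)^-1) : sl_solution B q 0 phi dphi ->
  (forall y, 0 < phi y) ->
  [/\ continuous (fun y => c * (p y * (q y * phi y - 0))),
   forall y, is_derive y (1 : R) (fun y => c * (p y * dphi y))
     (c * (p y * (q y * phi y - 0))),
   forall y, 0 <= c * (p y * (q y * phi y - 0)) &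
   forall y, phi y / W y <= c * (p y * (q y * phi y - 0))].
Proof.
move=> sphi phi0.
have c0 : 0 < c by rewrite invr_gt0 mulr_gt0.
split.
- move=> y; apply: cvgM; first exact: cvg_cst.
  apply: cvgM; first exact: is_derive_cvg (dp y).
  apply: cvgB; last exact: cvg_cst.
  by apply: cvgM; [exact: cq|exact: is_derive_cvg (sphi.1 y)].
- by move=> y; apply: is_derive1Z; exact: is_derive_flux sphi.
- by move=> y; rewrite subr0 !mulr_ge0// ltW.
- move=> y; rewrite divW subr0 /c.
  rewrite (_ : (q0 * w)^-1 * _ = p y * phi y / w * (q y / q0)); last first.
    by field; rewrite !gt_eqF.
  apply: ler_peMr; last by rewrite ler_pdivlMr ?mul1r.
  by rewrite divr_ge0 ?mulr_ge0 ?(ltW w_gt0) ?(ltW (p_gt0 _)) ?(ltW (phi0 _)).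
Qed.

Let le_pair phi g (D : set R) : measurable D -> continuous (fun z => phi z / W z) ->
  (forall y, 0 < phi y) -> (forall y, phi y / W y <= g y) ->
  mu.-integrable D (EFin \o g) ->
  mu.-integrable D (EFin \o (fun z => phi z / W z)) /\
  \int[mu]_(z in D) (phi z / W z) <= \int[mu]_(z in D) g z.
Proof.
move=> mD c phi0 le_g Ig.
have I1 : mu.-integrable D (EFin \o (fun z => phi z / W z)).
  apply: le_integrable Ig => //.
    by apply/measurable_EFinP/measurable_funTS; exact: continuous_measurable_fun.
  move=> x _; rewrite lee_fin ger0_norm ?divr_ge0 ?(ltW (phi0 _)) ?W_ge0//.
  by rewrite (le_trans (le_g x))// ler_norm.
by split => //; apply: le_Rintegral.
Qed.

(** As [dphi1 <= 0], the primitive of the majorant is at most [0], which is the bound passed to the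
    half-line integral. *)
Lemma pair_integral_itvcy y :
  mu.-integrable `[y, +oo[ (EFin \o (fun z => phi1 z / W z)) /\
  J1 y <= - (q0 * w)^-1 * (p y * dphi1 y).
Proof.
have [c d g0 le_g] := dominating s1 phi1_gt0.
have [x _|Ig le1] := @ge0_integral_itvcy _ _ _ y 0 c d (fun x _ => g0 x).
  apply: mulr_ge0_le0; first by rewrite invr_ge0 mulr_ge0 ?(ltW w_gt0) ?(ltW q0_gt0).
  by apply: mulr_ge0_le0; first exact: ltW.
have [I1 le2] := le_pair (measurable_itv _) (cphiW s1) phi1_gt0 le_g Ig.
by split => //; rewrite (le_trans le2)// (le_trans le1)// sub0r mulNr.
Qed.

Lemma pair_integral_itvNyc y :
  mu.-integrable `]-oo, y] (EFin \o (fun z => phi2 z / W z)) /\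
  J2 y <= (q0 * w)^-1 * (p y * dphi2 y).
Proof.
have [c d g0 le_g] := dominating s2 phi2_gt0.
have [x _|Ig le1] := @ge0_integral_itvNyc _ _ _ y 0 c d (fun x _ => g0 x).
  apply: mulr_ge0; first by rewrite invr_ge0 mulr_ge0 ?(ltW w_gt0) ?(ltW q0_gt0).
  by apply: mulr_ge0; first exact: ltW.
have [I2 le2] := le_pair (measurable_itv _) (cphiW s2) phi2_gt0 le_g Ig.
by split => //; rewrite (le_trans le2)// (le_trans le1)// subr0.
Qed.

Lemma is_derive_J2 y : is_derive y (1 : R) J2 (phi2 y / W y).
Proof.
have yy : y < y + 1 by rewrite ltrDl.
have [|D E] := continuous_FTC1 yy (pair_integral_itvNyc _).1 _ (cphiW s2 (x := y)).
  by rewrite ltNyr.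
by apply: DeriveDef; [exact: D|rewrite -derive1E; exact: E].
Qed.

(** The variable is the lower limit, so near [y] the integral is written as the constant
    [J1 (y - 1)] minus the integral from [y - 1], to which the fundamental theorem applies. *)
Lemma is_derive_J1 y : is_derive y (1 : R) J1 (- (phi1 y / W y)).
Proof.
have yy : y < y + 1 by rewrite ltrDl.
have y1 : y - 1 < y by rewrite gtrBl.
have I1 := (pair_integral_itvcy (y - 1)).1.
have I2 : mu.-integrable `[y - 1, y + 1] (EFin \o (fun z => phi1 z / W z)).
  apply: integrableS I1; [exact: measurable_itv|exact: measurable_itv|].
  exact: subset_itvl.
have [|D E] := continuous_FTC1 yy I2 _ (cphiW s1 (x := y)).
  by rewrite lte_fin.
have d : is_derive y (1 : R) (fun x => \int[mu]_(z in `[y - 1, x]) (phi1 z / W z))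
    (phi1 y / W y).
  by apply: DeriveDef; [exact: D|rewrite -derive1E; exact: E].
have := is_derive1B (is_derive1_cst (J1 (y - 1)) y) d; rewrite sub0r.
apply: near_eq_is_derive; near=> x.
have yx : y - 1 < x by near: x; exact: lt_nbhsr.
rewrite (Rintegral_itvB I1) ?bnd_simp ?(ltW yx)// Rintegral_itv_obnd_cbnd//.
apply: integrableS I1; [exact: measurable_itv|exact: measurable_itv|].
by apply: subset_itvr; rewrite bnd_simp ltW.
Unshelve. all: by end_near. Qed.

Lemma J2_ge0 y : 0 <= J2 y.
Proof. by apply: Rintegral_ge0 => x _; rewrite divr_ge0// ltW. Qed.

(** The mean value theorem on [[y, y + 1]] gives a strict decrease of [J1], whose values are
    nonnegative. *)
Lemma J1_gt0 y : 0 < J1 y.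
Proof.
have J1_ge0 z : 0 <= J1 z.
  by apply: Rintegral_ge0 => x _; rewrite divr_ge0// ltW.
have yy : y < y + 1 by rewrite ltrDl.
have [|z _] := @MVT _ J1 _ y (y + 1) yy (fun x _ => is_derive_J1 x).
  by apply: continuous_subspaceT => z; exact: is_derive_cvg (is_derive_J1 z).
rewrite addrAC subrr add0r mulr1 => E.
have : 0 < phi1 z / W z by rewrite divr_gt0 ?pair_wronskian_gt0.
have := J1_ge0 (y + 1); lra.
Qed.

Variable S : R.
Hypothesis S_gt0 : 0 < S.

Let hstar y := S * (phi1 y * J2 y + phi2 y * J1 y).
(** The product rule leaves only these terms: those from differentiating [J1] and [J2] are multiples
    of [phi1 phi2 / W] with opposite signs. *)
Let dhstar y := S * (dphi1 y * J2 y + dphi2 y * J1 y).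

Lemma sl_solution_hstar : sl_solution B q S hstar dhstar.
Proof.
split=> y.
  apply: (is_derive_eq (is_derive1Z S (is_derive1D
    (is_derive1M (s1.1 y) (is_derive_J2 y)) (is_derive1M (s2.1 y) (is_derive_J1 y))))).
  rewrite /dhstar; ring.
apply: (is_derive_eq (is_derive1Z S (is_derive1D
    (is_derive1M (s1.2 y) (is_derive_J2 y)) (is_derive1M (s2.2 y) (is_derive_J1 y))))).
rewrite /hstar /dhstar.
have W0 : W y != 0 by rewrite gt_eqF// pair_wronskian_gt0.
(* Here the limits of integration contribute [- W / W], which produces the source term [- S]. *)
have E : dphi1 y * (phi2 y / W y) - dphi2 y * (phi1 y / W y) = - 1.
  by rewrite !mulrA -mulrBl -opprB mulNr [dphi2 y * _]mulrC divff.
transitivity (q y * (S * (phi1 y * J2 y + phi2 y * J1 y)) -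
  B y * (S * (dphi1 y * J2 y + dphi2 y * J1 y)) +
  S * (dphi1 y * (phi2 y / W y) - dphi2 y * (phi1 y / W y))); first by ring.
by rewrite E mulrN1.
Qed.

Lemma hstar_gt0 y : 0 < hstar y.
Proof.
by rewrite mulr_gt0// ltr_wpDl ?mulr_gt0 ?J1_gt0 ?mulr_ge0 ?J2_ge0 ?(ltW (phi1_gt0 _)).
Qed.

Lemma hstar_le y : hstar y <= S / q0.
Proof.
rewrite ler_wpM2l ?(ltW S_gt0)//.
have h1 := ler_wpM2l (ltW (phi1_gt0 y)) (pair_integral_itvNyc y).2.
have h2 := ler_wpM2l (ltW (phi2_gt0 y)) (pair_integral_itvcy y).2.
apply: (le_trans (lerD h1 h2)).
rewrite (_ : _ + _ = (q0 * w)^-1 * (p y * W y)); last by rewrite /W; ring.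
by rewrite pW invfM divfK ?gt_eqF.
Qed.

Lemma bounded_solution_unique h dh : sl_solution B q S h dh -> bounded_fun h ->
  forall y, h y = hstar y.
Proof.
(* [bounded_fun] bounds [h] by every number above some [K]; [K + 1] is one such number. *)
move=> sh [K [_ /(_ (K + 1))]]; rewrite ltrDl => /(_ ltr01) hK y.
have su := sl_solutionB sh sl_solution_hstar; rewrite subrr in su.
apply/eqP; rewrite -subr_eq0; apply/eqP.
apply: (bounded_homogeneous_eq0 p_gt0 p_le dp q0_gt0 q_ge (K := K + 1 + S / q0) su) => z.
rewrite (le_trans (ler_normB _ _))// lerD//; first exact: hK.
by rewrite gtr0_norm ?hstar_gt0// hstar_le.
Qed.

Lemma bounded_hstar : bounded_fun hstar.
Proof.
exists (S / q0); split; first exact: num_real.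
by move=> K SK y _ /=; rewrite gtr0_norm ?hstar_gt0// (le_trans (hstar_le y))// ltW.
Qed.

Variable y0 : R.

Let general C1 C2 y := C1 * phi1 y + C2 * phi2 y +
  S * (phi1 y * oriented_integral y0 y (fun z => phi2 z / W z)
       - phi2 y * oriented_integral y0 y (fun z => phi1 z / W z)).

Lemma oriented_J2 y : oriented_integral y0 y (fun z => phi2 z / W z) = J2 y - J2 y0.
Proof. by rewrite (oriented_integralE _ _ (cphiW s2) is_derive_J2). Qed.

Lemma oriented_J1 y : oriented_integral y0 y (fun z => phi1 z / W z) = J1 y0 - J1 y.
Proof.
have d z : is_derive z (1 : R) (fun y => - J1 y) (phi1 z / W z).
  by rewrite -[phi1 z / W z]opprK; apply: is_derive1N; exact: is_derive_J1.
by rewrite (oriented_integralE _ _ (cphiW s1) d) opprK addrC.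
Qed.

(** Variation of constants. By Lagrange's identity, the Wronskians of [h] with [phi2] and [phi1],
    weighted by [p], differ from [S w J2] and [S w J1] by constants; Cramer's rule with [p W = w]
    recovers [h]. *)
Lemma solution_general h dh : sl_solution B q S h dh ->
  exists C1 C2, forall y, h y = general C1 C2 y.
Proof.
move=> sh.
have c1 y : p y * (h y * dphi2 y - dh y * phi2 y) - S * w * J2 y =
    p 0 * (h 0 * dphi2 0 - dh 0 * phi2 0) - S * w * J2 0.
  apply: (@is_derive_0_is_cst _ (fun y =>
    p y * (h y * dphi2 y - dh y * phi2 y) - S * w * J2 y)) => z.
  apply: (is_derive_eq (is_derive1B (is_derive_pW dp z sh s2)
     (is_derive1Z _ (is_derive_J2 z)))).
  by rewrite mul0r subr0 divW; field; rewrite gt_eqF.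
have c2 y : p y * (phi1 y * dh y - dphi1 y * h y) - S * w * J1 y =
    p 0 * (phi1 0 * dh 0 - dphi1 0 * h 0) - S * w * J1 0.
  apply: (@is_derive_0_is_cst _ (fun y =>
    p y * (phi1 y * dh y - dphi1 y * h y) - S * w * J1 y)) => z.
  apply: (is_derive_eq (is_derive1B (is_derive_pW dp z s1 sh)
     (is_derive1Z _ (is_derive_J1 z)))).
  by rewrite mul0r sub0r divW; field; rewrite gt_eqF.
move: (_ - _ * J2 0) c1 => C1 c1; move: (_ - _ * J1 0) c2 => C2 c2.
(* The terms in [y0] move the base point of the integrals from the infinite ends to [y0]. *)
exists (C1 / w + S * J2 y0), (C2 / w + S * J1 y0) => y.
rewrite /general oriented_J2 oriented_J1 -(c1 y) -(c2 y).
rewrite -(pW y) /W.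
field.
by rewrite -/(W y) !gt_eqF// pair_wronskian_gt0.
Qed.

(** Linear independence of [phi1] and [phi2]: if a combination with coefficients [d1], [d2]
    vanishes, so do its value and derivative at [0], and [W 0 != 0] forces [d1 = d2 = 0]. *)
Lemma hstar_general C1 C2 : (forall y, hstar y = general C1 C2 y) <->
  C1 = S * J2 y0 /\ C2 = S * J1 y0.
Proof.
have generalE D1 D2 y : general D1 D2 y - hstar y =
    (D1 - S * J2 y0) * phi1 y + (D2 - S * J1 y0) * phi2 y.
  by rewrite /general /hstar oriented_J2 oriented_J1; ring.
split=> [E|[-> ->] y]; last first.
  by apply/eqP; rewrite eq_sym -subr_eq0 generalE !subrr !mul0r addr0.
pose d1 := C1 - S * J2 y0; pose d2 := C2 - S * J1 y0.
have u0 : (fun y => d1 * phi1 y + d2 * phi2 y) = (fun=> 0).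
  by apply/funext => y; rewrite -generalE E subrr.
have e1 : d1 * phi1 0 + d2 * phi2 0 = 0 by exact: (congr1 (@^~ 0) u0).
have e2 : d1 * dphi1 0 + d2 * dphi2 0 = 0.
  rewrite -(is_derive1_derive (is_derive1D (is_derive1Z d1 (s1.1 0))
     (is_derive1Z d2 (s2.1 0)))).
  by rewrite u0 derive1_cst.
have W0 : W 0 != 0 by rewrite gt_eqF// pair_wronskian_gt0.
have /eqP : d1 * W 0 = 0.
  transitivity ((d1 * phi1 0 + d2 * phi2 0) * dphi2 0 -
    (d1 * dphi1 0 + d2 * dphi2 0) * phi2 0); first by rewrite /W; ring.
  by rewrite e1 e2 !mul0r subrr.
have /eqP : d2 * W 0 = 0.
  transitivity ((d1 * dphi1 0 + d2 * dphi2 0) * phi1 0 -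
    (d1 * phi1 0 + d2 * phi2 0) * dphi1 0); first by rewrite /W; ring.
  by rewrite e1 e2 !mul0r subrr.
rewrite !mulf_eq0 (negbTE W0) !orbF !subr_eq0.
by move=> /eqP -> /eqP ->.
Qed.

(** The result for general coefficients under the section hypotheses; the explicit equation has only
    to be checked against them. *)
Theorem decaying_pair : [/\
    forall h dh, sl_solution B q S h dh -> exists C1 C2, forall y, h y = general C1 C2 y,
    forall y, mu.-integrable `]-oo, y] (EFin \o (fun z => phi2 z / W z)) /\
      mu.-integrable `[y, +oo[ (EFin \o (fun z => phi1 z / W z)),
    forall h dh, sl_solution B q S h dh -> bounded_fun h -> forall y, h y = hstar y,
    [/\ sl_solution B q S hstar dhstar, bounded_fun hstar & forall y, 0 < hstar y] &
    forall C1 C2, (forall y, hstar y = general C1 C2 y) <->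
      C1 = S * J2 y0 /\ C2 = S * J1 y0].
Proof.
split.
- exact: solution_general.
- move=> y; split.
  + by have [] := pair_integral_itvNyc y.
  + by have [] := pair_integral_itvcy y.
- exact: bounded_solution_unique.
- by split; [exact: sl_solution_hstar|exact: bounded_hstar|exact: hstar_gt0].
- exact: hstar_general.
Qed.

End DecayingPair.

(** * The parabolic cylinder function and Weber's equation *)

Section Weber.
Context {R : realType}.
Implicit Types (al x y : R).

Lemma parabolic_cylinderE al x :
  parabolic_cylinder al x =
  expR (- (x ^+ 2 / 4)) / Gamma (- al) * pcf_integral (- al) x.
Proof. by []. Qed.

Lemma parabolic_cylinder_gt0 al x : al < 0 -> 0 < parabolic_cylinder al x.
Proof.
move=> al0; rewrite parabolic_cylinderE.
by rewrite mulr_gt0 ?divr_gt0 ?expR_gt0 ?Gamma_gt0 ?pcf_integral_gt0 ?oppr_gt0.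
Qed.

(** For [x >= 0] the factor [e^(-xt)] is at most [1]. The Gaussian is kept in the bound to
    compensate the growth of [e^(-I)]. *)
Lemma parabolic_cylinder_le al x : al < 0 -> 0 <= x -> parabolic_cylinder al x <=
  expR (- (x ^+ 2 / 4)) * (pcf_integral (- al) 0 / Gamma (- al)).
Proof.
move=> al0 x0; rewrite parabolic_cylinderE [leRHS]mulrA -[leLHS]mulrA -[leRHS]mulrA.
rewrite ler_wpM2l ?expR_ge0// mulrC.
rewrite ler_wpM2r ?invr_ge0 ?(ltW (Gamma_gt0 _)) ?oppr_gt0//.
have s0 : 0 < - al by rewrite oppr_gt0.
apply: le_Rintegral; [by []|exact: integrable_pcf_kernel|exact: integrable_pcf_kernel|].
move=> t; rewrite /= in_itv/= andbT => t0.
rewrite ler_wpM2l ?powR_ge0// ler_expR lerD2l mul0r oppr0 oppr_le0.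
by rewrite mulr_ge0// ltW.
Qed.

Definition dparabolic_cylinder al x : R :=
  expR (- (x ^+ 2 / 4)) / Gamma (- al) *
  (- (x / 2) * pcf_integral (- al) x - pcf_integral (- al + 1) x).

Let is_derive_gauss al x :
  is_derive x (1 : R) (fun x => expR (- (x ^+ 2 / 4)) / Gamma (- al))
    (expR (- (x ^+ 2 / 4)) / Gamma (- al) * - (x / 2)).
Proof.
have d : is_derive x (1 : R) (fun x => - (x ^+ 2 / 4)) (- (x / 2)).
  apply: (is_derive_eq (is_derive1N (is_derive1M
    (is_derive1M (is_derive_id x 1) (is_derive_id x 1)) (is_derive1_cst _ x)))).
  by field.
apply: (is_derive_eq (is_derive1M (is_derive1_expR d) (is_derive1_cst _ x))); ring.
Qed.

Lemma is_derive_parabolic_cylinder al x : al < 0 ->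
  is_derive x (1 : R) (parabolic_cylinder al) (dparabolic_cylinder al x).
Proof.
move=> al0; have s0 : 0 < - al by rewrite oppr_gt0.
apply: (is_derive_eq (is_derive1M (is_derive_gauss al x) (is_derive_pcf_integral x s0))).
rewrite /dparabolic_cylinder; ring.
Qed.

(** A second differentiation brings in the index [- al + 2], which the recurrence removes; what
    remains is Weber's equation. *)
Lemma is_derive_dparabolic_cylinder al x : al < 0 ->
  is_derive x (1 : R) (dparabolic_cylinder al)
    ((x ^+ 2 / 4 - (al + 2^-1)) * parabolic_cylinder al x).
Proof.
move=> al0; have s0 : 0 < - al by rewrite oppr_gt0.
have s1 : 0 < - al + 1 by rewrite addr_gt0.
have d : is_derive x (1 : R) (fun x => - (x / 2)) (- (2^-1)).
  apply: (is_derive_eq (is_derive1N (is_derive1M (is_derive_id x 1) (is_derive1_cst _ x)))).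
  by field.
apply: (is_derive_eq (is_derive1M (is_derive_gauss al x)
  (is_derive1B (is_derive1M d (is_derive_pcf_integral x s0))
    (is_derive_pcf_integral x s1)))).
have E2 : - al + 1 + 1 = - al + 2 by ring.
rewrite parabolic_cylinderE E2 pcf_integral_rec//.
move: (_ / Gamma _) => E; by field.
Qed.

Variables (al c ystar : R) (I dI ddI : R -> R).
Hypotheses (al_lt0 : al < 0) (hI : forall y, is_derive y (1 : R) I (dI y))
  (hdI : forall y, is_derive y (1 : R) dI (ddI y)).

Let x_ y := c * (y - ystar).
Let phi y := expR (- I y) * parabolic_cylinder al (x_ y).
Let dphi y := expR (- I y) *
  (c * dparabolic_cylinder al (x_ y) - dI y * parabolic_cylinder al (x_ y)).

(** The factor [e^(-I)] creates the first-order coefficient [2 I']. The zeroth-order one depends on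
    [c] only through [c^2], so both signs of [c] solve the same equation. *)
Lemma sl_solution_weber : sl_solution (fun y => 2 * dI y)
  (fun y => c ^+ 2 * (x_ y ^+ 2 / 4 - (al + 2^-1)) - dI y ^+ 2 - ddI y)
  0 phi (derive1 phi).
Proof.
have dx y : is_derive y (1 : R) x_ c.
  apply: (is_derive_eq (is_derive1Z c
    (is_derive1B (is_derive_id y 1) (is_derive1_cst ystar y)))).
  by rewrite subr0 mulr1.
have de y : is_derive y (1 : R) (fun y => expR (- I y)) (expR (- I y) * - dI y).
  exact: is_derive1_expR (is_derive1N (hI y)).
have dD y : is_derive y (1 : R) (fun y => parabolic_cylinder al (x_ y))
    (dparabolic_cylinder al (x_ y) * c).
  exact: is_derive1_comp (is_derive_parabolic_cylinder _ al_lt0) (dx y).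
have ddD y : is_derive y (1 : R) (fun y => dparabolic_cylinder al (x_ y))
    ((x_ y ^+ 2 / 4 - (al + 2^-1)) * parabolic_cylinder al (x_ y) * c).
  exact: is_derive1_comp (is_derive_dparabolic_cylinder _ al_lt0) (dx y).
have hphi y : is_derive y (1 : R) phi (dphi y).
  by apply: (is_derive_eq (is_derive1M (de y) (dD y))); rewrite /dphi; ring.
have -> : derive1 phi = dphi by apply/funext => y; exact: is_derive1_derive.
split=> // y.
apply: (is_derive_eq (is_derive1M (de y) (is_derive1B (is_derive1Z c (ddD y))
  (is_derive1M (hdI y) (dD y))))).
rewrite /phi /dphi; ring.
Qed.

End Weber.

(** * Passage to the explicit coefficients *)

Lemma quadratic_le (R : realType) (A b y : R) : 0 < A ->
  b * y - A * y ^+ 2 <= b ^+ 2 / (4 * A).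
Proof.
move=> A0; rewrite -subr_ge0.
rewrite (_ : _ - _ = (2 * A * y - b) ^+ 2 / (4 * A)); last by field; rewrite gt_eqF.
by rewrite divr_ge0 ?sqr_ge0// mulr_ge0// ltW.
Qed.

(** Division by [A] normalises the leading coefficient, and the derivative becomes an explicit
    function [dh]. *)
Lemma solves_linear_ode2P (R : realType) (A S : R) (B q b c h : R -> R) : 0 < A ->
  (forall y, b y = A * B y) -> (forall y, c y = A * q y) ->
  solves_linear_ode2 A b c (A * S) h <-> exists dh, sl_solution B q S h dh.
Proof.
move=> A0 bE cE; split=> [[dh ddh E]|[dh [hh hdh]]].
  exists (derive1 h); split=> y.
    by apply: DeriveDef; [exact: dh|rewrite derive1E].
  apply: DeriveDef; first exact: ddh.
  have := E y; rewrite bE cE /= derive1E => Ey.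
  apply: (mulfI (lt0r_neq0 A0)); lra.
have dhE : derive1 h = dh by apply/funext => y; exact: is_derive1_derive.
split=> y.
- by have [] := hh y.
- by rewrite dhE; have [] := hdh y.
- by rewrite bE cE /= dhE (is_derive1_derive (hdh y)); ring.
Qed.

Theorem proposition5p1 (R : realType)
  (r sigma k theta a beta rho delta gamma : R)
  (r_gt0 : 0 < r) (sigma_gt0 : 0 < sigma) (k_gt0 : 0 < k)
  (theta_gt0 : 0 < theta) (a_gt0 : 0 < a) (beta_gt0 : 0 < beta)
  (rho_in01 : 0 < rho < 1) (delta_gt0 : 0 < delta) (gamma_gt1 : 1 < gamma)
  (chi psi : R)
  (chiE : chi = gamma / (gamma + (1 - gamma) * rho ^+ 2))
  (psiE1 : psi = 1 + (1 - gamma) / chi)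
  (psiE2 : psi = 2 - gamma + (1 - gamma) ^+ 2 / gamma * rho ^+ 2)
  (psi_in01 : 0 < psi < 1)
  (K0 K1 K2 m ystar nu alpha : R)
  (K0E : K0 = (gamma - 1) / chi * (r - delta * psi / (psi - 1)))
  (K2E : K2 = (gamma - 1) / (2 * gamma * chi))
  (K1E : K1 = k + (1 - gamma^-1) * a * rho)
  (mE : m = Num.sqrt (2 * K2 / a ^+ 2 + K1 ^+ 2 / a ^+ 4))
  (ystarE : ystar = k * theta * K1 / (a ^+ 4 * m ^+ 2))
  (nuE : nu = K1 / a ^+ 2 - 2 * K0 / a ^+ 2 - k ^+ 2 * theta ^+ 2 / a ^+ 4
              + m ^+ 2 * ystar ^+ 2)
  (alphaE : alpha = nu / (2 * m) - 2^-1)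
  (I phi1 phi2 W : R -> R)
  (IE : I = fun y => k * theta / a ^+ 2 * y - K1 / (2 * a ^+ 2) * y ^+ 2)
  (phi1E : phi1 = fun y =>
     expR (- I y) * parabolic_cylinder alpha (Num.sqrt (2 * m) * (y - ystar)))
  (phi2E : phi2 = fun y =>
     expR (- I y) * parabolic_cylinder alpha (- Num.sqrt (2 * m) * (y - ystar)))
  (WE : W = wronskian phi1 phi2)
  (solution : (R -> R) -> Prop)
  (solutionE : solution =
     solves_linear_ode2 (a ^+ 2 / 2)
       (fun y => k * theta - (k + (1 - gamma^-1) * a * rho) * y)
       (fun y => K0 + K2 * y ^+ 2)
       (beta `^ psi))
  (y0 : R)
  (general : R -> R -> R -> R)
  (generalE : general = fun C1 C2 y =>
     C1 * phi1 y + C2 * phi2 y +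
     2 * beta `^ psi / a ^+ 2 *
       (phi1 y * oriented_integral y0 y (fun z => phi2 z / W z)
        - phi2 y * oriented_integral y0 y (fun z => phi1 z / W z)))
  (hstar : R -> R)
  (hstarE : hstar = fun y =>
     2 * beta `^ psi / a ^+ 2 *
       (phi1 y * (\int[lebesgue_measure]_(z in `]-oo, y]) (phi2 z / W z))
        + phi2 y * (\int[lebesgue_measure]_(z in `[y, +oo[) (phi1 z / W z)))) :
  [/\ (* the general form *)
      forall h, solution h ->
        exists C1 C2 : R, forall y, h y = general C1 C2 y,
      (* the improper integrals converge *)
      forall y,
        lebesgue_measure.-integrable `]-oo, y] (EFin \o (fun z => phi2 z / W z))
        /\
        lebesgue_measure.-integrable `[y, +oo[ (EFin \o (fun z => phi1 z / W z)),
      (* hstar is the unique bounded positive solution *)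
      forall h : R -> R,
        [/\ solution h, bounded_fun h & forall y, 0 < h y] <->
        (forall y, h y = hstar y) &
      (* its constants in the general form *)
      forall C1 C2 : R,
        (forall y, hstar y = general C1 C2 y) <->
        C1 = 2 * beta `^ psi / a ^+ 2 *
               \int[lebesgue_measure]_(z in `]-oo, y0]) (phi2 z / W z) /\
        C2 = 2 * beta `^ psi / a ^+ 2 *
               \int[lebesgue_measure]_(z in `[y0, +oo[) (phi1 z / W z)].
Proof.
set S := 2 * beta `^ psi / a ^+ 2 in generalE hstarE *.
have rho0 : 0 < rho by case/andP: rho_in01.
have a_neq0 : a != 0 by rewrite gt_eqF.
have gamma_gt0 : 0 < gamma := lt_trans ltr01 gamma_gt1.
have /andP[psi0 psi1] := psi_in01.
(* The sign is read off [psi - 1 = (1 - gamma) / chi < 0] with [gamma > 1]. *)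
have chi_gt0 : 0 < chi.
  have : (1 - gamma) / chi < 0 by move: psi1; rewrite psiE1; lra.
  by rewrite -invr_gt0 nmulr_rlt0// subr_lt0.
have K0_gt0 : 0 < K0.
  rewrite K0E mulr_gt0 ?divr_gt0 ?subr_gt0// (@lt_trans _ _ 0)//.
  by rewrite nmulr_llt0 ?invr_lt0 ?subr_lt0// mulr_gt0.
have K2_gt0 : 0 < K2.
  by rewrite K2E divr_gt0 ?subr_gt0// !mulr_gt0.
have K1_gt0 : 0 < K1.
  by rewrite K1E addr_gt0// mulr_gt0// mulr_gt0// subr_gt0 invf_lt1//.
have m2E : m ^+ 2 = 2 * K2 / a ^+ 2 + K1 ^+ 2 / a ^+ 4.
  by rewrite mE sqr_sqrtr// addr_ge0// divr_ge0 ?mulr_ge0 ?exprn_ge0 ?(ltW K2_gt0) ?(ltW K1_gt0) ?(ltW a_gt0)//.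
(* Strict because [K2 > 0]; this lets the Gaussian dominate [e^(-I)] and helps to bound [nu]. *)
have m_gt : K1 / a ^+ 2 < m.
  rewrite -(@ltr_pXn2r _ 2)// ?nnegrE ?divr_ge0 ?exprn_ge0 ?(ltW K1_gt0) ?(ltW a_gt0)//.
    by rewrite m2E expr_div_n -exprM ltrDr divr_gt0 ?mulr_gt0 ?exprn_gt0//.
  by rewrite mE sqrtr_ge0.
have m_gt0 : 0 < m by rewrite (lt_trans _ m_gt)// divr_gt0 ?exprn_gt0.
have m2y : m ^+ 2 * ystar = k * theta * K1 / a ^+ 4.
  by rewrite ystarE; field; rewrite a_neq0 gt_eqF.
(* Since [m^2 >= K1^2 / a^4], the term [m^2 ystar^2] is at most [(k theta)^2 / a^4]; hence
   [nu < K1 / a^2 < m], and so [alpha < 0]. *)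
have nu_lt : nu < m.
  have e : m ^+ 2 * ystar ^+ 2 <= k ^+ 2 * theta ^+ 2 / a ^+ 4.
    have -> : m ^+ 2 * ystar ^+ 2 = (k * theta * K1 / a ^+ 4) ^+ 2 / m ^+ 2.
      by rewrite -m2y; field; rewrite gt_eqF.
    rewrite ler_pdivrMr ?exprn_gt0// m2E.
    rewrite (_ : _ * (_ + _) = (k * theta * K1 / a ^+ 4) ^+ 2 +
      2 * K2 * (k * theta) ^+ 2 / a ^+ 6); last by field.
    by rewrite lerDl divr_ge0 ?exprn_ge0 ?(ltW a_gt0)// mulr_ge0 ?sqr_ge0// mulr_ge0// ltW.
  have : 0 < 2 * K0 / a ^+ 2 by rewrite divr_gt0 ?mulr_gt0 ?exprn_gt0.
  rewrite nuE; lra.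
have alpha_lt0 : alpha < 0.
  by rewrite alphaE subr_lt0 ltr_pdivrMr ?mulr_gt0// mulrA mulVf ?mul1r//.
pose dI y := k * theta / a ^+ 2 - K1 / a ^+ 2 * y.
have hI y : is_derive y (1 : R) I (dI y).
  rewrite IE; apply: (is_derive_eq (is_derive1B
    (is_derive1Z (k * theta / a ^+ 2) (is_derive_id y 1))
    (is_derive1Z (K1 / (2 * a ^+ 2)) (is_derive1M (is_derive_id y 1) (is_derive_id y 1))))).
  by rewrite /dI; field.
have hdI y : is_derive y (1 : R) dI (- (K1 / a ^+ 2)).
  apply: (is_derive_eq (is_derive1B (is_derive1_cst _ y)
    (is_derive1Z (K1 / a ^+ 2) (is_derive_id y 1)))).
  by rewrite mulr1 sub0r.
(* Coefficients after division by [a^2 / 2]; [p = e^(2I)] then satisfies [p' = B p]. *)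
pose q y := 2 * (K0 + K2 * y ^+ 2) / a ^+ 2.
pose B y := 2 * dI y.
pose p y := expR (2 * I y).
have c2 : Num.sqrt (2 * m) ^+ 2 = 2 * m by rewrite sqr_sqrtr// mulr_ge0// ltW.
(* The constants [m], [ystar] and [nu] come from completing the square:
   [q + I'^2 + I'' = m^2 (y - ystar)^2 - nu]. *)
have qE (c y : R) : c ^+ 2 = 2 * m ->
    c ^+ 2 * ((c * (y - ystar)) ^+ 2 / 4 - (alpha + 2^-1)) - dI y ^+ 2 - - (K1 / a ^+ 2) = q y.
  move=> cE; rewrite exprMn cE alphaE subrK.
  rewrite (_ : 2 * m * (2 * m * (y - ystar) ^+ 2 / 4 - nu / (2 * m)) =
    m ^+ 2 * y ^+ 2 - 2 * (m ^+ 2 * ystar) * y + m ^+ 2 * ystar ^+ 2 - nu); last first.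
    by field; rewrite gt_eqF.
  by rewrite nuE m2y m2E /dI /q; field.
have sl c : c ^+ 2 = 2 * m ->
    let phi := fun y => expR (- I y) * parabolic_cylinder alpha (c * (y - ystar)) in
    sl_solution B q 0 phi (derive1 phi).
  move=> cE; have := sl_solution_weber c ystar alpha_lt0 hI hdI.
  rewrite (_ : (fun y => _ - _ - - _) = q)//.
  by apply/funext => y; exact: qE.
have s1 : sl_solution B q 0 phi1 (derive1 phi1) by rewrite phi1E; exact: sl.
have s2 : sl_solution B q 0 phi2 (derive1 phi2).
  by rewrite phi2E; apply: sl; rewrite sqrrN.
have phi1_gt0 y : 0 < phi1 y.
  by rewrite phi1E mulr_gt0 ?expR_gt0 ?parabolic_cylinder_gt0.
have phi2_gt0 y : 0 < phi2 y.
  by rewrite phi2E mulr_gt0 ?expR_gt0 ?parabolic_cylinder_gt0.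
have p_gt0 y : 0 < p y by exact: expR_gt0.
have dp y : is_derive y (1 : R) p (B y * p y).
  apply: (is_derive_eq (is_derive1_expR (is_derive1Z 2 (hI y)))).
  by rewrite mulrC.
(* As [K1 > 0], [2 I] is a concave quadratic; [M] is the exponential of its maximum. *)
have [M p_le] : exists M, forall y, p y <= M.
  exists (expR ((2 * (k * theta / a ^+ 2)) ^+ 2 / (4 * (K1 / a ^+ 2)))) => y.
  rewrite ler_expR IE (le_trans _ (quadratic_le _ y _)) ?divr_gt0 ?exprn_gt0//.
  by rewrite le_eqVlt; apply/orP; left; apply/eqP; field.
have q0_gt0 : 0 < 2 * K0 / a ^+ 2 by rewrite divr_gt0 ?mulr_gt0 ?exprn_gt0.
have q_ge y : 2 * K0 / a ^+ 2 <= q y.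
  rewrite ler_pM2r ?invr_gt0 ?exprn_gt0// ler_pM2l// lerDl.
  by rewrite mulr_ge0 ?sqr_ge0// ltW.
have cq : continuous q.
  move=> y; apply: cvgM; last exact: cvg_cst.
  apply: cvgM; first exact: cvg_cst.
  apply: cvgD; first exact: cvg_cst.
  by apply: cvgM; [exact: cvg_cst|exact: exprn_continuous].
have [K phi_le] : exists K, forall c y, c ^+ 2 = 2 * m -> 0 <= c * (y - ystar) ->
    expR (- I y) * parabolic_cylinder alpha (c * (y - ystar)) <= K.
  (* [A] and [b] come from [- I y - m (y - ystar)^2 / 2 = b y - A y^2 - m ystar^2 / 2], the exponent
     left once the cylinder function is bounded by its Gaussian. *)
  pose A := (m - K1 / a ^+ 2) / 2.
  have A_gt0 : 0 < A by rewrite divr_gt0// subr_gt0.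
  pose b := m * ystar - k * theta / a ^+ 2.
  exists (expR (b ^+ 2 / (4 * A) - m * ystar ^+ 2 / 2) *
    (pcf_integral (- alpha) 0 / Gamma (- alpha))) => c y cE x0.
  rewrite (le_trans (ler_wpM2l (expR_ge0 _) (parabolic_cylinder_le alpha_lt0 x0)))//.
  rewrite [leLHS]mulrA -expRD; apply: ler_wpM2r.
    have s0 : 0 < - alpha by rewrite oppr_gt0.
    have F0 := pcf_integral_gt0 0 s0; have G0 := Gamma_gt0 s0.
    exact/ltW/divr_gt0.
  rewrite ler_expR exprMn cE IE lerBrDr (le_trans _ (quadratic_le b y A_gt0))//.
  by rewrite le_eqVlt; apply/orP; left; apply/eqP; rewrite /b /A; field.
have c_ge0 : 0 <= Num.sqrt (2 * m) by exact: sqrtr_ge0.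
(* The cylinder function has a nonnegative argument right of [ystar] in [phi1] and left of it in
   [phi2]. *)
have phi1_le y : ystar <= y -> phi1 y <= K.
  by move=> h; rewrite phi1E; apply: phi_le => //; rewrite mulr_ge0// subr_ge0.
have phi2_le y : y <= ystar -> phi2 y <= K.
  move=> h; rewrite phi2E; apply: phi_le; first by rewrite sqrrN.
  by rewrite mulNr -mulrN opprB mulr_ge0// subr_ge0.
have S_gt0 : 0 < S by rewrite divr_gt0 ?mulr_gt0 ?powR_gt0 ?exprn_gt0.
have solP h : solution h <-> exists dh, sl_solution B q S h dh.
  rewrite solutionE (_ : beta `^ psi = a ^+ 2 / 2 * S); last by rewrite /S; field.
  apply: solves_linear_ode2P; first by rewrite divr_gt0 ?exprn_gt0.
    by move=> y; rewrite -K1E /B /dI; field.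
  by move=> y; rewrite /q; field.
have [gen_h int_phi uniq_h [sol_hst bnd_hst hst_gt0] consts] :=
  decaying_pair p_gt0 p_le dp q0_gt0 q_ge cq s1 s2 phi1_gt0 phi2_gt0
    phi1_le phi2_le S_gt0 y0.
rewrite hstarE generalE WE; split.
- by move=> h /solP[dh]; exact: gen_h.
- exact: int_phi.
- move=> h; split=> [[/solP[dh sh] bh _]|/funext ->]; first exact: uniq_h sh bh.
  split; [by apply/solP; eexists; exact: sol_hst|exact: bnd_hst|exact: hst_gt0].
- exact: consts.
Qed.
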